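(* Let $t>1$ and run the RM-Algorithm with parameter $t$ on servers $S$ and requests $r_1,\dots,r_n$ ($|S|=n$) in a metric space with metric $d$. Let $M$ be the resulting online matching and let $M_H\subseteq M$ be the set of its short edges. Then $$\Big(4+\frac{4}{t-1}\Big)w(M_H)\ge w(M).$$
   Context: The cost of a set of edges is $w(M)=\sum_{(s,r)\in M}d(s,r)$. Given a matching $M^*$ between servers and requests, a vertex not matched by $M^*$ is free; an augmenting path with respect to $M^*$ is a simple path between two free vertices whose edges alternate between edges not in $M^*$ and edges in $M^*$. The $t$-net-cost of an augmenting path $P$ with respect to $M^*$ is $$\phi_t(P)=t\sum_{(s,r)\in P\setminus M^*}d(s,r)-\sum_{(s,r)\in P\cap M^*}d(s,r),$$ and its length is $\ell(P)=\sum_{(s,r)\in P}d(s,r)$. RM-Algorithm (parameter $t$): it maintains an online matching $M$ and an offline matching $M^*$, both initially empty. When request $r_i$ arrives (phase $i$), with $M^*_{i-1}$ the current offline matching: (1) compute an augmenting path $P_i$ of minimum $t$-net-cost with respect to $M^*_{i-1}$, starting at $r_i$ and ending at some free server $s_i$ (ties are broken in favour of fewest edges); (2) set $M^*_i=M^*_{i-1}\oplus P_i$ (symmetric difference) and add $(s_i,r_i)$ to $M$. The final online matching is $M=\{(s_1,r_1),\dots,(s_n,r_n)\}$. $P_i$ is called short if $\ell(P_i)\le\frac{4}{t-1}\phi_t(P_i)$ (with $\phi_t(P_i)$ taken with respect to $M^*_{i-1}$), and the edge $(s_i,r_i)$ of $M$ is called short if $P_i$ is short. *)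

(* Defs.v *)
From mathcomp Require Import all_boot all_order all_algebra.
From mathcomp Require Import reals topology.

Set Implicit Arguments.
Unset Strict Implicit.
Unset Printing Implicit Defensive.

Import Order.TTheory GRing.Theory Num.Theory.
Local Open Scope ring_scope.

(* Servers form a finite type S and requests are indexed, in order of arrival,
   by 'I_n.  Vertices and edges of the complete bipartite graph are those of
   the abstract indices, so distinct servers or requests may be located at the
   same point of the metric space. *)
Notation vertex S n := (S + 'I_n)%type.
Notation edge S n := (S * 'I_n)%type.

Section BipartiteGraph.
Variables (S : finType) (n : nat).
Implicit Types (u v : vertex S n) (p : seq (vertex S n)).
Implicit Types (M : {set edge S n}).

Definition edge_of u v : option (edge S n) :=
  match u, v with
  | inl s, inr i => Some (s, i)
  | inr i, inl s => Some (s, i)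
  | _, _ => None
  end.

Definition adjacent u v : bool := isSome (edge_of u v).

Definition incident v (e : edge S n) : bool :=
  match v with
  | inl s => e.1 == s
  | inr i => e.2 == i
  end.

Definition is_free M v : bool := [forall e in M, ~~ incident v e].

(* As in path.v, a walk with vertices u :: p is given by u and p. *)
Definition walk_edges u p : seq (edge S n) := pmap id (pairmap edge_of u p).

Definition path_edges u p : {set edge S n} := [set e in walk_edges u p].

Definition alternating M (es : seq (edge S n)) : bool :=
  sorted (fun e f => (e \in M) != (f \in M)) es.

Definition augmenting_path M u v p : bool :=
  [&& path adjacent u p, last u p == v, u != v, uniq (u :: p),
      is_free M u, is_free M v & alternating M (walk_edges u p)].

Definition symdiff (A B : {set edge S n}) : {set edge S n} :=
  (A :\: B) :|: (B :\: A).

End BipartiteGraph.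

Section RMAlgorithm.
Variables (R : realType) (X : metricType R) (S : finType) (n : nat).
Variables (srv : S -> X) (req : 'I_n -> X) (t : R).
Implicit Types (M P : {set edge S n}) (p : seq (vertex S n)).

Definition cost M : R := \sum_(e in M) mdist (srv e.1) (req e.2).

Definition net_cost M P : R := t * cost (P :\: M) - cost (P :&: M).

(* Requests that have not arrived yet are vertices of the graph too, but they
   are free, so no alternating path from [inr i] to a server visits them. *)
Definition rm_choice M (i : 'I_n) (s : S) p : Prop :=
  augmenting_path M (inr i) (inl s) p /\
  forall (s' : S) p', augmenting_path M (inr i) (inl s') p' ->
    let P := path_edges (inr i) p in
    let P' := path_edges (inr i) p' in
    net_cost M P <= net_cost M P' /\
    (net_cost M P = net_cost M P' -> (#|P| <= #|P'|)%N).

(* [Mstar k] is the offline matching after k requests have been processed, so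
   request i : 'I_n is handled with respect to [Mstar i]; [inr i :: p i] is the
   augmenting path chosen for it and [s i] is the free server it ends at. *)
Record rm_run (s : 'I_n -> S) (p : 'I_n -> seq (vertex S n))
    (Mstar : nat -> {set edge S n}) : Prop := RmRun {
  rm_init : Mstar 0%N = set0;
  rm_step : forall i : 'I_n, rm_choice (Mstar i) i (s i) (p i);
  rm_update : forall i : 'I_n,
    Mstar i.+1 = symdiff (Mstar i) (path_edges (inr i) (p i)) }.

Definition is_short M P : bool := cost P <= 4 / (t - 1) * net_cost M P.

Definition online_matching (s : 'I_n -> S) : {set edge S n} :=
  [set (s i, i) | i : 'I_n].

Definition short_edges (s : 'I_n -> S) (p : 'I_n -> seq (vertex S n))
    (Mstar : nat -> {set edge S n}) : {set edge S n} :=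
  [set (s i, i) |
     i : 'I_n & is_short (Mstar i) (path_edges (inr i) (p i))].

End RMAlgorithm.

(* Main.v *)
(** Write [A], [B] for the costs of [P_i :\: M*] and [P_i :&: M*].  Then
    [phi_t(P_i) = (t - 1) / 2 * (A + B) + (t + 1) / 2 * (A - B)], where
    [A + B] is the length of [P_i] and [A - B] is the increase of the cost of
    the offline matching, which telescopes to a nonnegative quantity.  Hence
    [(t - 1) / 2] times the total length is at most the sum of the net-costs.
    The paths that are not short contribute at most [(t - 1) / 4] times their
    length to that sum, so the total length is at most [4 / (t - 1)] times the
    net-cost of the short paths.  Finally [d(s_i, r_i)] is at most the length
    of [P_i] by the triangle inequality, and [phi_t(P_i) <= t * d(s_i, r_i)]
    because the single edge [(s_i, r_i)] is also an augmenting path. *)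

Require Import Defs.
From mathcomp Require Import all_boot all_order all_algebra.
From mathcomp Require Import reals topology.
From mathcomp Require Import ring lra.

Set Implicit Arguments.
Unset Strict Implicit.
Unset Printing Implicit Defensive.

Import Order.TTheory GRing.Theory Num.Theory.
Local Open Scope ring_scope.

Section WalkEdges.
Variables (S : finType) (n : nat).
Implicit Types (u v w : vertex S n) (p : seq (vertex S n)).

Lemma edge_of_incident u v e w :
  edge_of u v = Some e -> incident w e = (w == u) || (w == v).
Proof.
case: u v => [s|i] [s'|j] //= [<-]; case: w => [s''|k] /=.
- by rewrite (inj_eq (@inl_inj _ _)) orbF eq_sym.
- by rewrite (inj_eq (@inr_inj _ _)) eq_sym.
- by rewrite (inj_eq (@inl_inj _ _)) eq_sym.
- by rewrite (inj_eq (@inr_inj _ _)) orbF eq_sym.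
Qed.

Lemma walk_edges_incident u p w e :
  e \in walk_edges u p -> incident w e -> w \in u :: p.
Proof.
elim: p u => [|v p IHp] u //; rewrite /walk_edges /=.
have IH : e \in walk_edges v p -> incident w e -> w \in u :: v :: p.
  by move=> ep /(IHp v ep); rewrite [in X in _ -> X]inE => ->; rewrite orbT.
case uv: (edge_of u v) => [f|] //=; rewrite inE => /orP[/eqP->|//].
by rewrite (edge_of_incident _ uv) !inE orbA => ->.
Qed.

Lemma path_edges_cons u v p f : edge_of u v = Some f ->
  path_edges u (v :: p) = f |: path_edges v p.
Proof. by move=> uv; apply/setP => e; rewrite !inE /walk_edges /= uv /= inE. Qed.

(** The edge [f] touches [u], whereas the edges of a walk touch only vertices of that walk. *)
Lemma notin_path_edges u v p f : uniq (u :: v :: p) ->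
  edge_of u v = Some f -> f \notin path_edges v p.
Proof.
move=> /andP[uvp _] uv; rewrite inE; apply: contra uvp => fp.
by apply: (walk_edges_incident fp); rewrite (edge_of_incident _ uv) eqxx.
Qed.

End WalkEdges.

Section Cost.
Variables (R : realType) (X : metricType R) (S : finType) (n : nat).
Variables (srv : S -> X) (req : 'I_n -> X) (t : R).
Implicit Types (M P : {set edge S n}) (p : seq (vertex S n)).

Local Notation cost := (cost srv req).
Local Notation net_cost := (net_cost srv req t).

Lemma cost_ge0 M : 0 <= cost M.
Proof. by apply: sumr_ge0 => e _; exact: mdist_ge0. Qed.

Lemma cost_set1 e : cost [set e] = mdist (srv e.1) (req e.2).
Proof. by rewrite /Defs.cost big_set1. Qed.

Lemma cost_split M P : cost P = cost (P :\: M) + cost (P :&: M).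
Proof. by rewrite /Defs.cost (big_setID M) addrC. Qed.

Lemma cost_symdiff M P :
  cost (symdiff M P) = cost M + cost (P :\: M) - cost (P :&: M).
Proof.
rewrite (cost_split P M) setIC addrAC addrK /Defs.cost -bigU /=.
  by apply: eq_bigl => e; rewrite !inE.
by rewrite -setI_eq0; apply/eqP/setP => e; rewrite !inE; do 2 case: (e \in _).
Qed.

(** The request index in each pair makes the indexing injective, whatever [f] is. *)
Lemma cost_graph (f : 'I_n -> S) (I : {pred 'I_n}) :
  cost [set (f i, i) | i in I] = \sum_(i in I) mdist (srv (f i)) (req i).
Proof. by rewrite /Defs.cost big_imset //= => i j _ _ []. Qed.

Lemma net_costE M P :
  net_cost M P =
  (t - 1) / 2 * cost P + (t + 1) / 2 * (cost (symdiff M P) - cost M).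
Proof. by rewrite /Defs.net_cost cost_symdiff (cost_split M P); field. Qed.

Definition location (v : vertex S n) : X :=
  match v with inl s => srv s | inr i => req i end.

Lemma mdist_edge_of u v e : edge_of u v = Some e ->
  mdist (location u) (location v) = mdist (srv e.1) (req e.2).
Proof. by case: u v => [s|i] [s'|j] //= [<-] //=; rewrite metric_sym. Qed.

(** Induction with the triangle inequality. Simplicity of the path makes its first edge new, so the
    cost of the edge set splits off that edge as a summand. *)
Lemma mdist_le_cost_path u p : path (@adjacent S n) u p -> uniq (u :: p) ->
  mdist (location u) (location (last u p)) <= cost (path_edges u p).
Proof.
elim: p u => [|v p IHp] u /=; first by rewrite mdistxx cost_ge0.
rewrite -/(uniq (v :: p)) -/(uniq (u :: v :: p)) => /andP[].
rewrite /adjacent; case uv: (edge_of u v) => [f|] // _ vp uniq_uvp.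
rewrite (path_edges_cons _ uv) /Defs.cost big_setU1 ?(notin_path_edges _ uv)//=.
rewrite -(mdist_edge_of uv); apply: le_trans (metric_triangle _ (location v) _) _.
by rewrite lerD2l; apply: IHp => //; case/andP: uniq_uvp.
Qed.

Lemma mdist_le_cost_augmenting M s i p : augmenting_path M (inr i) (inl s) p ->
  mdist (srv s) (req i) <= cost (path_edges (inr i) p).
Proof.
move=> /and5P[pp /eqP lastp _ uniq_p _].
by have := mdist_le_cost_path pp uniq_p; rewrite lastp /= metric_sym.
Qed.

Lemma augmenting_edge M s i p : augmenting_path M (inr i) (inl s) p ->
  augmenting_path M (inr i) (inl s) [:: inl s].
Proof.
by move=> /and5P[_ _ _ _ /and3P[free_i free_s _]]; apply/and5P; split => //;
  apply/and3P.
Qed.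

Hypothesis t_gt1 : 1 < t.

(** Charging the edges of [M] at rate [t] as well makes the bound usable for the edge [(s, i)]
    without checking that it lies outside [M]. *)
Lemma net_cost_le M P : net_cost M P <= t * cost P.
Proof.
rewrite /Defs.net_cost (cost_split M P) mulrDr lerD2l.
apply: le_trans (_ : 0 <= _); rewrite ?oppr_le0 ?mulr_ge0 ?cost_ge0 //.
exact/ltW/(lt_trans ltr01).
Qed.

Lemma rm_choice_net_cost_le M i s p : rm_choice srv req t M i s p ->
  net_cost M (path_edges (inr i) p) <= t * mdist (srv s) (req i).
Proof.
move=> [aug_p min_p]; have [le_p _] := min_p _ _ (augmenting_edge aug_p).
apply: le_trans le_p _; apply: le_trans (net_cost_le _ _) _.
have e : edge_of (inr i) (inl s) = Some (s, i) by [].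
by rewrite (path_edges_cons _ e) (_ : path_edges _ _ = set0) ?setU0 ?cost_set1 //.
Qed.

End Cost.

Theorem lemma2 (R : realType) (X : metricType R) (S : finType) (n : nat)
    (srv : S -> X) (req : 'I_n -> X) (t : R)
    (s : 'I_n -> S) (p : 'I_n -> seq (vertex S n))
    (Mstar : nat -> {set edge S n})
    (card_S : #|S| = n) (t_gt1 : 1 < t)
    (run : rm_run srv req t s p Mstar) :
  (4 + 4 / (t - 1)) * cost srv req (short_edges srv req t s p Mstar)
    >= cost srv req (online_matching s).
Proof.
case: run => init step update.
pose P (i : 'I_n) := path_edges (inr i) (p i).
pose short (i : 'I_n) := is_short srv req t (Mstar i) (P i).
pose len (i : 'I_n) := cost srv req (P i).
pose phi (i : 'I_n) := net_cost srv req t (Mstar i) (P i).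
pose d (i : 'I_n) := mdist (srv (s i)) (req i).
have t1_gt0 : 0 < t - 1 by rewrite subr_gt0.
have le_len : \sum_i (t - 1) / 2 * len i <= \sum_i phi i.
  rewrite -subr_ge0 -sumrB.
  under eq_bigr => i _ do
    rewrite /phi net_costE -update addrAC subrr add0r.
  rewrite -mulr_sumr mulr_ge0 //; first by lra.
  (* As [Mstar 0] is empty, the increments telescope to the cost of [Mstar n]. *)
  rewrite -(big_mkord xpredT
    (fun k => cost srv req (Mstar k.+1) - cost srv req (Mstar k))).
  by rewrite telescope_sumr // init {2}/cost big_set0 subr0 cost_ge0.
(* The slack [(t - 1) / 2 * len i - phi i] has nonpositive sum by [le_len], so it vanishes on
   summation. If the path is short, [t * d i] pays for [phi i]; otherwise the slack alone exceeds
   [(t - 1) / 4 * len i]. *)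
have term_le i : (t - 1) / 4 * d i <=
    (t - 1) / 2 * len i - phi i + (if short i then t * d i else 0).
  have d_le : d i <= len i := mdist_le_cost_augmenting srv req (step i).1.
  have d_ge0 : 0 <= d i := mdist_ge0 _ _.
  case: ifPn => [_|].
    have : phi i <= t * d i := rm_choice_net_cost_le t_gt1 (step i).
    by nra.
  rewrite /short /is_short -/(len i) -/(phi i) -ltNge => long_i.
  have : phi i < (t - 1) / 4 * len i.
    by rewrite -ltr_pdivrMl ?divr_gt0 // invf_div.
  by nra.
have sum_le : (t - 1) / 4 * \sum_i d i <= t * \sum_(i | short i) d i.
  rewrite !mulr_sumr; apply: le_trans (ler_sum _ (fun i _ => term_le i)) _.
  rewrite big_split sumrB /= -big_mkcond /=.
  by rewrite gerDr subr_le0.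
have -> : cost srv req (short_edges srv req t s p Mstar) =
    \sum_(i | short i) d i.
  by rewrite cost_graph; apply: eq_bigl => i; rewrite inE.
(* Scaling by [(t - 1) / 4] turns the factor [4 + 4 / (t - 1)] into [t]. *)
rewrite cost_graph -(ler_pM2l (_ : 0 < (t - 1) / 4)) ?divr_gt0 //.
apply: le_trans sum_le _; rewrite [leRHS]mulrA.
by have -> : (t - 1) / 4 * (4 + 4 / (t - 1)) = t by field; rewrite gt_eqF.
Qed.
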